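(* Let $\theta^0,\theta^\infty_1,\theta^\infty_2\in\mathbb{C}$ with $\theta^0+\theta^\infty_1+\theta^\infty_2=0$. Let $q_1,p_1,q_2,p_2,u$ be holomorphic functions of $(t_1,t_2)$ on a domain of $\{t_1\neq0\}\subset\mathbb{C}^2$, with $u\neq0$. Put $G=\mathrm{diag}(1,u)$, $E_2=\mathrm{diag}(0,1)$ and $$\hat A_0^{(-1)}=\begin{pmatrix}q_2\\ 1\end{pmatrix}(-q_1,\,q_1q_2+t_1),\quad \hat A_0^{(0)}=\begin{pmatrix}-p_1q_1+p_2q_2&-q_2(p_2q_2-\theta^0)+p_1(2q_1q_2+t_1)\\ p_2&p_1q_1-p_2q_2+\theta^0\end{pmatrix},$$ $$\hat A_\infty^{(-1)}=\begin{pmatrix}0&p_1q_1-p_2q_2-\theta^\infty_1\\ -1&-t_2\end{pmatrix},\quad \hat B_1=\begin{pmatrix}0&-(p_1q_1-p_2q_2-\theta^\infty_1)\\ 1&0\end{pmatrix}.$$ Consider the linear systems $\frac{\partial Y}{\partial x}=AY$, $\frac{\partial Y}{\partial t_i}=B^{(i)}Y$ $(i=1,2)$ with $$A=G^{-1}\left(\frac{\hat A_0^{(-1)}}{x^2}+\frac{\hat A_0^{(0)}}{x}+\hat A_\infty^{(-1)}+E_2x\right)G,\quad B^{(1)}=-\frac1{t_1x}G^{-1}\hat A_0^{(-1)}G,\quad B^{(2)}=-E_2x+G^{-1}\hat B_1G .$$ Then the compatibility conditions $\partial_{t_i}A-\partial_xB^{(i)}+[A,B^{(i)}]=O$ for $i=1,2$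 (for all $x$) are equivalent to the Hamiltonian system $$\frac{\partial q_j}{\partial t_i}=\frac{\partial H_{t_i}}{\partial p_j},\qquad \frac{\partial p_j}{\partial t_i}=-\frac{\partial H_{t_i}}{\partial q_j}\qquad(i,j=1,2),$$ $$H_{t_1}=H_{\mathrm{III}}(D_6)(-\theta^\infty_1,\theta^0+1;t_1;q_1,p_1)-p_1-\frac{q_1q_2}{t_1}(q_2-p_2+t_2)+p_1p_2-q_2,$$ $$H_{t_2}=H_{\mathrm{IV}}(\theta^0,\theta^\infty_1;t_2;q_2,p_2)-p_1q_1(p_2-2q_2-t_2)-q_1q_2+t_1p_1,$$ together with $$\frac1u\frac{\partial u}{\partial t_1}=-\frac{q_1}{t_1},\qquad \frac1u\frac{\partial u}{\partial t_2}=t_2-p_2 .$$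
   Context: $H_{\mathrm{IV}}(\alpha,\beta;t;q,p)=pq(p-q-t)+\beta p+\alpha q$ is the Hamiltonian of the fourth Painlevé equation, and $tH_{\mathrm{III}}(D_6)(\alpha,\beta;t;q,p)=p^2q^2-(q^2-\beta q-t)p-\alpha q$ defines the Hamiltonian of the third Painlevé equation of type $D_6$. The Hamiltonians $H_{t_1},H_{t_2}$ are those of the degenerate Garnier system $H_{\mathrm{Gar}}^{3+2}$; the linear system has irregular singularities at $x=0,\infty$, of spectral type $((1))((1)),(1)(1)$. *)

(* Defs.v *)
From HB Require Import structures.
From mathcomp Require Import all_boot all_order all_algebra.
From mathcomp Require Import complex.
From mathcomp Require Import all_classical all_reals all_analysis.

Set Implicit Arguments.
Unset Strict Implicit.
Unset Printing Implicit Defensive.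

Import Order.TTheory GRing.Theory Num.Theory.
Import numFieldNormedType.Exports.

Local Open Scope classical_set_scope.
Local Open Scope ring_scope.

(* Typing the complex numbers as a numFieldType is what gives them, and CC * CC,
   the normed-module structure over CC itself, so that differentiable, 'D_v
   and derive1 below are the complex notions. *)
Definition CC (R : realType) : numFieldType := (R[i])%C.

Section Calculus.
Context {R : realType}.
Local Notation C := (CC R).

Definition domain (D : set (C * C)) : Prop :=
  [/\ open D, connected D & D !=set0].

(* Joint complex (Frechet) differentiability in (t1, t2) at each point of D. *)
Definition holomorphic_on (D : set (C * C)) (f : C * C -> C) : Prop :=
  forall t, D t -> differentiable f t.

(* Directions such that 'D_dt1 and 'D_dt2 are the partial derivatives in t1, t2. *)
Definition dt1 : C * C := (1, 0).
Definition dt2 : C * C := (0, 1).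

Definition mx_pderive (v : C * C) (M : C * C -> 'M[C]_2) (t : C * C) : 'M[C]_2 :=
  \matrix_(i, j) 'D_v (fun s => M s i j) t.

Definition mx_derive1 (M : C -> 'M[C]_2) (x : C) : 'M[C]_2 :=
  \matrix_(i, j) derive1 (fun y => M y i j) x.

(* d_t A - d_x B + [A, B], with d_t the derivative in the direction v. *)
Definition zero_curvature (v : C * C) (A B : C * C -> C -> 'M[C]_2)
    (t : C * C) (x : C) : 'M[C]_2 :=
  mx_pderive v (fun s => A s x) t - mx_derive1 (B t) x
  + (A t x *m B t x - B t x *m A t x).

End Calculus.

Section Matrices.
Context {R : realType}.
Local Notation C := (CC R).

Definition row2 (a b : C) : 'rV[C]_2 := \row_j (if j == 0 then a else b).
Definition col2 (a b : C) : 'cV[C]_2 := \col_i (if i == 0 then a else b).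
Definition mx2 (a b c d : C) : 'M[C]_2 :=
  \matrix_(i, j) (if i == 0 then if j == 0 then a else b
                  else if j == 0 then c else d).

Definition Gmx (u : C) : 'M[C]_2 := diag_mx (row2 1 u).
Definition E2 : 'M[C]_2 := diag_mx (row2 0 1).

Definition hatA0m1 (t1 q1 q2 : C) : 'M[C]_2 :=
  col2 q2 1 *m row2 (- q1) (q1 * q2 + t1).

Definition hatA00 (th0 t1 q1 p1 q2 p2 : C) : 'M[C]_2 :=
  mx2 (- p1 * q1 + p2 * q2)
      (- q2 * (p2 * q2 - th0) + p1 * (2 * q1 * q2 + t1))
      p2
      (p1 * q1 - p2 * q2 + th0).

Definition hatAoom1 (thoo1 t2 q1 p1 q2 p2 : C) : 'M[C]_2 :=
  mx2 0 (p1 * q1 - p2 * q2 - thoo1) (-1) (- t2).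

Definition hatB1 (thoo1 q1 p1 q2 p2 : C) : 'M[C]_2 :=
  mx2 0 (- (p1 * q1 - p2 * q2 - thoo1)) 1 0.

End Matrices.

Section LaxPair.
Context {R : realType}.
Local Notation C := (CC R).
Context (th0 thoo1 : C) (q1 p1 q2 p2 u : C * C -> C).

Definition gauge (t : C * C) (M : 'M[C]_2) : 'M[C]_2 :=
  invmx (Gmx (u t)) *m M *m Gmx (u t).

Definition laxA (t : C * C) (x : C) : 'M[C]_2 :=
  gauge t (x ^- 2 *: hatA0m1 t.1 (q1 t) (q2 t)
           + x^-1 *: hatA00 th0 t.1 (q1 t) (p1 t) (q2 t) (p2 t)
           + hatAoom1 thoo1 t.2 (q1 t) (p1 t) (q2 t) (p2 t)
           + x *: E2).

Definition laxB1 (t : C * C) (x : C) : 'M[C]_2 :=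
  - (t.1 * x)^-1 *: gauge t (hatA0m1 t.1 (q1 t) (q2 t)).

Definition laxB2 (t : C * C) (x : C) : 'M[C]_2 :=
  - (x *: E2) + gauge t (hatB1 thoo1 (q1 t) (p1 t) (q2 t) (p2 t)).

End LaxPair.

Section Hamiltonians.
Context {R : realType}.
Local Notation C := (CC R).

Definition HIV (alpha beta t q p : C) : C :=
  p * q * (p - q - t) + beta * p + alpha * q.

Definition HIII_D6 (alpha beta t q p : C) : C :=
  (p ^+ 2 * q ^+ 2 - (q ^+ 2 - beta * q - t) * p - alpha * q) / t.

Definition Ht1 (th0 thoo1 t1 t2 q1 p1 q2 p2 : C) : C :=
  HIII_D6 (- thoo1) (th0 + 1) t1 q1 p1
  - p1 - q1 * q2 / t1 * (q2 - p2 + t2) + p1 * p2 - q2.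

Definition Ht2 (th0 thoo1 t1 t2 q1 p1 q2 p2 : C) : C :=
  HIV th0 thoo1 t2 q2 p2
  - p1 * q1 * (p2 - 2 * q2 - t2) - q1 * q2 + t1 * p1.

(* Hamilton's equations at t for the time variable with direction v, where
   H = H(t1, t2, q1, p1, q2, p2); the partial derivatives of H in q_j, p_j are
   taken with the other five variables frozen. *)
Definition hamilton_eqs (v : C * C) (H : C -> C -> C -> C -> C -> C -> C)
    (q1 p1 q2 p2 : C * C -> C) (t : C * C) : Prop :=
  [/\ 'D_v q1 t = derive1 (fun p => H t.1 t.2 (q1 t) p (q2 t) (p2 t)) (p1 t),
      'D_v p1 t = - derive1 (fun q => H t.1 t.2 q (p1 t) (q2 t) (p2 t)) (q1 t),
      'D_v q2 t = derive1 (fun p => H t.1 t.2 (q1 t) (p1 t) (q2 t) p) (p2 t) &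
      'D_v p2 t = - derive1 (fun q => H t.1 t.2 (q1 t) (p1 t) q (p2 t)) (q2 t)].

End Hamiltonians.

(* Main.v *)
Require Import Defs.
From HB Require Import structures.
From mathcomp Require Import all_boot all_order all_algebra.
From mathcomp Require Import complex.
From mathcomp Require Import all_classical all_reals all_analysis.
From mathcomp Require Import ring.
Import Order.TTheory GRing.Theory Num.Theory.
Import numFieldNormedType.Exports.
Local Open Scope classical_set_scope.
Local Open Scope ring_scope.

(** The equivalence holds pointwise in t, and separately for each of the two
    times. Three ideas reduce it to a triangular linear system.

    Gauge covariance. Conjugating by G = diag(1, u) turns the zero-curvature
    expression of (A, B) into G^-1 (dA - dB/dx + [A, B + diag(0, w)]) G, where
    A and B are now the hatted matrices and w = (du/dt) / u is the logarithmic
    derivative of u ([zero_curvature_gauge]). Conjugation is injective, so u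
    enters the compatibility conditions through w only.

    Laurent expansion. The hatted curvature has the form x^-2 P2 + x^-1 P1 + P0,
    since the terms of positive degree in x cancel ([curvature_t1_laurent],
    [curvature_t2_laurent]); it vanishes for all nonzero x if and only if
    P2 = P1 = P0 = 0 ([mx_laurent_eq0]).

    Solving for the derivatives. The 12 scalar equations P2 = P1 = P0 = 0 are
    linear in the derivatives of q1, p1, q2, p2 and in w. The entries (2,1) of
    P0, P2 and P1 give w, dq1 and dp2, in this order. The derivatives of q2 and
    p1 occur in single entries only with coefficients, such as q1, that may
    vanish; but contracting P2 with the row (1, -q2) and the column (q2, 1)
    gives dq2 with the coefficient t1, which is nonzero, and then the same
    contraction of P1 gives dp1 with the coefficient t1. Conversely all 12
    equations become identities once the solution is substituted
    ([curvature_t1_coeffs_eq0], [curvature_t2_coeffs_eq0]). The solution is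
    Hamilton's vector field together with the stated equation for u
    ([hamilton_eqs_Ht1], [hamilton_eqs_Ht2]). *)

Set Implicit Arguments.
Unset Strict Implicit.

(** * Rules for directional derivatives *)

Section Derivatives.
Context {K : numFieldType} {V : normedModType K}.
Implicit Types (f g : V -> K) (x v : V).

Lemma is_derive_addf f g x v df dg :
  is_derive x v f df -> is_derive x v g dg ->
  is_derive x v (fun s => f s + g s) (df + dg).
Proof. exact: is_deriveD. Qed.

Lemma is_derive_oppf f x v df :
  is_derive x v f df -> is_derive x v (fun s => - f s) (- df).
Proof. exact: is_deriveN. Qed.

Lemma is_derive_mulf f g x v df dg :
  is_derive x v f df -> is_derive x v g dg ->
  is_derive x v (fun s => f s * g s) (df * g x + f x * dg).
Proof.
by move=> fdf gdg; rewrite addrC [df * _]mulrC; exact: is_deriveM.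
Qed.

Lemma is_derive_expf f n x v df :
  is_derive x v f df ->
  is_derive x v (fun s => f s ^+ n) (n%:R * f x ^+ n.-1 * df).
Proof.
move=> ?; have -> : (fun s => f s ^+ n) = f ^+ n.
  by apply/funext => s; rewrite exprfctE.
exact: is_deriveX.
Qed.

Lemma is_derive_invf f x v df : f x != 0 ->
  is_derive x v f df -> is_derive x v (fun s => (f s)^-1) (- (f x) ^- 2 * df).
Proof.
move=> fx0 fdf; apply: DeriveDef.
  by apply: derivableV => //; exact: ex_derive.
by rewrite [LHS](deriveV fx0) // (@derive_val _ _ _ _ _ _ _ fdf).
Qed.

End Derivatives.

(** Along the line through x in the direction v the difference quotient is
    constantly equal to f v. *)
Lemma is_derive_linear {K : numFieldType} {V : normedModType K}
    (f : V -> K) (x v : V) :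
  (forall h : K, f (h *: v + x) = h * f v + f x) -> is_derive x v f (f v).
Proof.
move=> flin.
have cst_quotient :
    (fun h : K => h^-1 *: ((f \o shift x) (h *: v) - f x)) @ 0^' --> f v.
  apply: (@cvg_trans _ (cst (f v) @ 0^')); last exact: cvg_cst.
  apply: near_eq_cvg; near=> h => /=.
  rewrite flin addrK scalerA mulVf ?scale1r //.
  by near: h; exact: nbhs_dnbhs_neq.
apply: DeriveDef; first by apply/cvg_ex; exists (f v).
exact: cvg_lim cst_quotient.
Unshelve. all: by end_near. Qed.

Lemma is_derive_fst {K : numFieldType} (x v : K * K) : is_derive x v fst v.1.
Proof. exact: is_derive_linear. Qed.

Lemma is_derive_snd {K : numFieldType} (x v : K * K) : is_derive x v snd v.2.
Proof. exact: is_derive_linear. Qed.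

(** Differentiates a closed expression by recursion on its syntax, leaving the
    derivatives of unknown functions to the context. The rules above are
    pointwise so that this match on the syntax can apply them. The class
    [is_derive] is kept out of instance search, which is slow on composite
    expressions, and the functions f and g are passed explicitly because
    unification would eta-contract them and so hide their shape from the next
    match. *)
Ltac derive_rules :=
  lazymatch goal with
  | |- is_derive _ _ (fun _ => ?c) _ =>
      notypeclasses refine (is_derive_cst _ _ _)
  | |- is_derive _ _ (fun s => s) _ => notypeclasses refine (is_derive_id _ _)
  | |- is_derive _ _ (fun _ => @fst _ _ _) _ =>
      notypeclasses refine (is_derive_fst _ _)
  | |- is_derive _ _ (fun _ => @snd _ _ _) _ =>
      notypeclasses refine (is_derive_snd _ _)
  | |- is_derive _ _ (fun s => @?f s + @?g s) _ =>
      notypeclasses refine (is_derive_addf (f := f) (g := g) _ _); derive_rules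
  | |- is_derive _ _ (fun s => - @?f s) _ =>
      notypeclasses refine (is_derive_oppf (f := f) _); derive_rules
  | |- is_derive _ _ (fun s => @?f s * @?g s) _ =>
      notypeclasses refine (is_derive_mulf (f := f) (g := g) _ _); derive_rules
  | |- is_derive _ _ (fun s => @?f s ^+ ?n) _ =>
      notypeclasses refine (is_derive_expf (f := f) n _); derive_rules
  | |- _ => eassumption
  end.

(** The derivative computed by the rules is compared with the expected one by
    the tactic given as argument. *)
Ltac derive_by tac :=
  notypeclasses refine (is_derive_eq _ _);
  [ derive_rules | rewrite /=; tac ].

(** * Two-by-two matrices by their entries *)

Section LaxPairs.
Context {R : realType}.
Local Notation C := (CC R).

Lemma mx2D (a b c d a' b' c' d' : C) :
  mx2 a b c d + mx2 a' b' c' d' = mx2 (a + a') (b + b') (c + c') (d + d').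
Proof. by apply/matrixP => i j; rewrite !mxE; case: ifP; case: ifP. Qed.

Lemma mx2N (a b c d : C) : - mx2 a b c d = mx2 (- a) (- b) (- c) (- d).
Proof. by apply/matrixP => i j; rewrite !mxE; case: ifP; case: ifP. Qed.

Lemma mx2Z (k a b c d : C) :
  k *: mx2 a b c d = mx2 (k * a) (k * b) (k * c) (k * d).
Proof. by apply/matrixP => i j; rewrite !mxE; case: ifP; case: ifP. Qed.

Lemma mx2M (a b c d a' b' c' d' : C) :
  mx2 a b c d *m mx2 a' b' c' d' =
  mx2 (a * a' + b * c') (a * b' + b * d') (c * a' + d * c') (c * b' + d * d').
Proof.
apply/matrixP => i j; rewrite !mxE !big_ord_recl big_ord0 addr0 !mxE /=.
by case: ifP; case: ifP.
Qed.

Lemma mx2_eta (M : 'M[C]_2) : M = mx2 (M 0 0) (M 0 1) (M 1 0) (M 1 1).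
Proof.
apply/matrixP => i j; rewrite mxE.
by case: (unliftP 0 i) => [i'|] ->; case: (unliftP 0 j) => [j'|] -> /=;
  rewrite ?ord1 //; congr (M _ _); apply/val_inj.
Qed.

Lemma mx2P (M : 'M[C]_2) : exists a b c d, M = mx2 a b c d.
Proof. by exists (M 0 0), (M 0 1), (M 1 0), (M 1 1); exact: mx2_eta. Qed.

Lemma mx2_eq0 (a b c d : C) :
  mx2 a b c d = 0 <-> [/\ a = 0, b = 0, c = 0 & d = 0].
Proof.
split=> [M0|[-> -> -> ->]].
  have E i j := congr1 (fun N : 'M[C]_2 => N i j) M0.
  by move: (E 0 0) (E 0 1) (E 1 0) (E 1 1); rewrite !mxE.
by apply/matrixP => i j; rewrite !mxE; case: ifP; case: ifP.
Qed.

Lemma GmxE (u : C) : Gmx u = mx2 1 0 0 u.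
Proof. by rewrite [LHS]mx2_eta !mxE /= ?mulr1n ?mulr0n. Qed.

Lemma E2E : E2 = mx2 0 0 0 1 :> 'M[C]_2.
Proof. by rewrite [LHS]mx2_eta !mxE /= ?mulr1n ?mulr0n. Qed.

Definition mx2E := (mx2M, mx2N, mx2Z, mx2D).

(** At u = 0 both sides are diag(1, 0), by the conventions that the inverse of
    0 is 0 and that invmx is the identity on singular matrices. Hence the
    entries of a gauge transform have one formula in a whole neighbourhood,
    and it can be differentiated without localizing to nonzero u. *)
Lemma invmx_Gmx (u : C) : invmx (Gmx u) = Gmx u^-1.
Proof.
have [->|u0] := eqVneq u 0.
  rewrite invr0 /invmx ifN // unitmxE det_diag !big_ord_recl big_ord0 !mxE /=.
  by rewrite mul1r mul0r unitr0.
have GV : Gmx u *m Gmx u^-1 = 1%:M.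
  rewrite !GmxE mx2E [RHS]mx2_eta !mxE /= !mulfV //.
  by congr mx2; ring.
have [Gu _] := mulmx1_unit GV.
by rewrite -[LHS]mulmx1 -GV mulKmx.
Qed.

(** * Conjugation by diag(1, u) *)

Section Gauge.
Variables (u : C * C -> C) (t : C * C).

Lemma gaugeE (M : 'M[C]_2) :
  gauge u t M = mx2 (M 0 0) (M 0 1 * u t) ((u t)^-1 * M 1 0)
                    ((u t)^-1 * M 1 1 * u t).
Proof.
rewrite /gauge invmx_Gmx !GmxE {1}(mx2_eta M) !mx2E.
by congr mx2; ring.
Qed.

Lemma gaugeD (M N : 'M[C]_2) : gauge u t (M + N) = gauge u t M + gauge u t N.
Proof. by rewrite /gauge mulmxDr mulmxDl. Qed.

Lemma gaugeN (M : 'M[C]_2) : gauge u t (- M) = - gauge u t M.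
Proof. by rewrite /gauge mulmxN mulNmx. Qed.

Lemma gaugeZ (k : C) (M : 'M[C]_2) : gauge u t (k *: M) = k *: gauge u t M.
Proof. by rewrite /gauge -scalemxAr -scalemxAl. Qed.

Hypothesis u0 : u t != 0.

Lemma gaugeM (M N : 'M[C]_2) : gauge u t (M *m N) = gauge u t M *m gauge u t N.
Proof.
have GU : Gmx (u t) \in unitmx.
  by rewrite unitmxE det_diag !big_ord_recl big_ord0 !mxE /= mul1r mulr1 unitfE.
by rewrite /gauge !mulmxA mulmxK.
Qed.

Lemma gauge_E2 : gauge u t E2 = E2.
Proof. by rewrite gaugeE E2E !mxE /=; congr mx2; field. Qed.

Lemma gauge_eq0 (M : 'M[C]_2) : gauge u t M = 0 <-> M = 0.
Proof.
rewrite gaugeE mx2_eq0 {5}(mx2_eta M) mx2_eq0.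
have V0 : (u t)^-1 != 0 by rewrite invr_eq0.
split=> -[m00 m01 m10 m11]; split=> //.
- by apply: (mulIf u0); rewrite mul0r.
- by apply: (mulfI V0); rewrite mulr0.
- by apply: (mulfI V0); apply: (mulIf u0); rewrite mulr0 mul0r.
- by rewrite m01 mul0r.
- by rewrite m10 mulr0.
- by rewrite m11 mulr0 mul0r.
Qed.
End Gauge.

(** * Entrywise derivatives and gauge covariance *)

Section MxDerive.
Context {V : normedModType C}.
Implicit Types (t v : V) (M : V -> 'M[C]_2).

Definition mx_is_derive t v M (dM : 'M[C]_2) :=
  forall i j, is_derive t v (fun s => M s i j) (dM i j).

Lemma mx_is_deriveD t v M N dM dN :
  mx_is_derive t v M dM -> mx_is_derive t v N dN ->
  mx_is_derive t v (fun s => M s + N s) (dM + dN).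
Proof.
move=> MdM NdN i j; under eq_fun do rewrite mxE.
by rewrite mxE; exact: is_deriveD.
Qed.

Lemma mx_is_deriveZ t v M k dM : mx_is_derive t v M dM ->
  mx_is_derive t v (fun s => k *: M s) (k *: dM).
Proof.
move=> MdM i j; under eq_fun do rewrite mxE.
rewrite mxE; have := MdM i j => dMij.
exact: is_deriveZ.
Qed.

Lemma mx_is_derive_cst t v (M : 'M[C]_2) : mx_is_derive t v (fun=> M) 0.
Proof. by move=> i j; rewrite mxE; exact: is_derive_cst. Qed.

Lemma mx_is_derive_mx2 t v (a b c d : V -> C) a' b' c' d' :
  is_derive t v a a' -> is_derive t v b b' ->
  is_derive t v c c' -> is_derive t v d d' ->
  mx_is_derive t v (fun s => mx2 (a s) (b s) (c s) (d s)) (mx2 a' b' c' d').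
Proof.
move=> ? ? ? ? i j; under eq_fun do rewrite mxE.
by rewrite mxE; case: ifP; case: ifP.
Qed.
End MxDerive.

Lemma mx_pderive_val (v t : C * C) M dM :
  mx_is_derive t v M dM -> mx_pderive v M t = dM.
Proof.
move=> MdM; apply/matrixP => i j; rewrite mxE.
exact: (@derive_val _ _ _ _ _ _ _ (MdM i j)).
Qed.

Lemma mx_derive1_val (x : C) M dM :
  mx_is_derive x (1 : C) M dM -> mx_derive1 M x = dM.
Proof.
move=> MdM; apply/matrixP => i j; rewrite mxE derive1E.
exact: (@derive_val _ _ _ _ _ _ _ (MdM i j)).
Qed.

Definition lie (M N : 'M[C]_2) : 'M[C]_2 := M *m N - N *m M.

(** The logarithmic derivative dG G^-1 of G = diag(1, u), where w = du / u. *)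
Definition gauge_form (w : C) : 'M[C]_2 := mx2 0 0 0 w.

Lemma lieDr (M N N' : 'M[C]_2) : lie M (N + N') = lie M N + lie M N'.
Proof. by rewrite /lie mulmxDr mulmxDl opprD addrACA. Qed.

Lemma lie_gauge_form (M : 'M[C]_2) w :
  lie M (gauge_form w) = mx2 0 (M 0 1 * w) (- (w * M 1 0)) 0.
Proof.
rewrite /lie {1 2}(mx2_eta M) /gauge_form !mx2E.
by congr mx2; ring.
Qed.

(** d(G^-1 M G) = G^-1 (dM + [M, dG G^-1]) G. *)
Lemma gauge_derive (v t : C * C) u M du dM : u t != 0 ->
  is_derive t v u du -> mx_is_derive t v M dM ->
  mx_is_derive t v (fun s => gauge u s (M s))
    (gauge u t (dM + lie (M t) (gauge_form ((u t)^-1 * du)))).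
Proof.
move=> u0 udu MdM; under eq_fun do rewrite gaugeE.
have d00 := MdM 0 0; have d01 := MdM 0 1.
have d10 := MdM 1 0; have d11 := MdM 1 1.
have Vdu := is_derive_invf u0 udu.
rewrite gaugeE lie_gauge_form !mxE /=.
by notypeclasses refine (mx_is_derive_mx2 _ _ _ _); derive_by ltac:(by field).
Qed.

(** Zero curvature is covariant under a gauge transformation: B picks up the
    term dG G^-1, which does not depend on x and so leaves dB/dx unchanged. *)
Lemma zero_curvature_gauge (v t : C * C) (x : C) u Ah (Bh : C -> 'M[C]_2) B
    du dA dB :
  u t != 0 -> is_derive t v u du ->
  mx_is_derive t v (fun s => Ah s x) dA ->
  mx_is_derive x (1 : C) Bh dB ->
  B t = (fun y => gauge u t (Bh y)) ->
  zero_curvature v (fun s y => gauge u s (Ah s y)) B t x =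
  gauge u t (dA - dB + lie (Ah t x) (Bh x + gauge_form ((u t)^-1 * du))).
Proof.
move=> u0 udu AdA BdB BE; rewrite /zero_curvature BE.
rewrite (mx_pderive_val (gauge_derive u0 udu AdA)).
have -> : mx_derive1 (fun y => gauge u t (Bh y)) x = gauge u t dB.
  apply: mx_derive1_val; under eq_fun do rewrite gaugeE.
  have d00 := BdB 0 0; have d01 := BdB 0 1.
  have d10 := BdB 1 0; have d11 := BdB 1 1.
  rewrite gaugeE; notypeclasses refine (mx_is_derive_mx2 _ _ _ _);
    by derive_by ltac:(ring).
have -> (w : 'M[C]_2) : dA - dB + lie (Ah t x) (Bh x + w) =
    dA + lie (Ah t x) w - dB + lie (Ah t x) (Bh x).
  rewrite lieDr; move: (lie _ w) (lie _ _) => W L.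
  by rewrite [L + W]addrC addrA [dA + W - dB]addrAC.
set P := dA + lie _ _; clearbody P.
rewrite (gaugeD _ _ (P - dB)) (gaugeD _ _ P) (gaugeN _ _ dB).
by rewrite [in RHS]/lie (gaugeD _ _ (_ *m _)) gaugeN !gaugeM.
Qed.

(** * Laurent coefficients of the curvature *)

(** The values at 1, -1 and 2 already determine the three coefficients. *)
Lemma laurent_eq0 (a b c : C) :
  (forall x : C, x != 0 -> x ^- 2 * a + x^-1 * b + c = 0) ->
  [/\ a = 0, b = 0 & c = 0].
Proof.
move=> abc.
have two0 : (2 : C) != 0 by rewrite pnatr_eq0.
have three0 : (3 : C) != 0 by rewrite pnatr_eq0.
have one0 : (1 : C) != 0 by rewrite oner_eq0.
have e1 := abc 1 one0.
have eN : (-1) ^- 2 * a + (-1)^-1 * b + c = 0 by apply: abc; rewrite oppr_eq0.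
have e2 := abc 2 two0.
have b0 : b = 0.
  apply: (mulfI two0); rewrite mulr0 -[RHS](subrr 0) -{1}e1 -eN.
  by field.
have c0 : c = 0.
  apply: (mulfI three0).
  have -> : 3 * c = 4 * (2 ^- 2 * a + 2^-1 * b + c)
      - (1 ^- 2 * a + 1^-1 * b + c) - b by field.
  by rewrite e1 e2 b0 !mulr0 !subrr.
move: e1; rewrite b0 c0 mulr0 !addr0 expr1n invr1 mul1r => a0.
by split.
Qed.

Lemma mx_laurent_eq0 (a b c : 'M[C]_2) :
  (forall x : C, x != 0 -> x ^- 2 *: a + x^-1 *: b + c = 0) <->
  [/\ a = 0, b = 0 & c = 0].
Proof.
split=> [abc|[-> -> ->] x _]; last by rewrite !scaler0 !addr0.
have ent i j : [/\ a i j = 0, b i j = 0 & c i j = 0].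
  apply: laurent_eq0 => x x0.
  by have := congr1 (fun M : 'M[C]_2 => M i j) (abc x x0); rewrite !mxE.
by split; apply/matrixP => i j; rewrite mxE; case: (ent i j).
Qed.

(** The matrices da, db, dc stand for the t1-derivatives of the coefficients a,
    b, c of A, and the term with (t1 x^2)^-1 is dB/dx. The term x E2 of A
    commutes with diag(0, w), so it contributes to degree 0 only. *)
Lemma curvature_t1_laurent (a b c da db dc : 'M[C]_2) (t1 w x : C) :
  t1 != 0 -> x != 0 ->
  x ^- 2 *: da + x^-1 *: db + dc - (t1 * x ^+ 2)^-1 *: a
    + lie (x ^- 2 *: a + x^-1 *: b + c + x *: E2)
          (- (t1 * x)^-1 *: a + gauge_form w)
  = x ^- 2 *: (da + lie a (gauge_form w) - t1^-1 *: (a + lie b a))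
    + x^-1 *: (db + lie b (gauge_form w) - t1^-1 *: lie c a)
    + (dc + lie c (gauge_form w) - t1^-1 *: lie E2 a).
Proof.
move=> t10 x0.
have [a1 [a2 [a3 [a4 ->]]]] := mx2P a; have [b1 [b2 [b3 [b4 ->]]]] := mx2P b.
have [c1 [c2 [c3 [c4 ->]]]] := mx2P c; have [d1 [d2 [d3 [d4 ->]]]] := mx2P da.
have [e1 [e2 [e3 [e4 ->]]]] := mx2P db; have [f1 [f2 [f3 [f4 ->]]]] := mx2P dc.
rewrite /lie /gauge_form E2E !mx2E.
by congr mx2; field; rewrite t10 x0.
Qed.

(** The summand E2 is -dB/dx. The terms of degree 1 cancel because
    [E2, B] = [c, E2], which is where the specific c and B are needed. *)
Lemma curvature_t2_laurent (a b da db dc : 'M[C]_2)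
    (thoo1 t2 q1 p1 q2 p2 w x : C) :
  x != 0 ->
  let c := hatAoom1 thoo1 t2 q1 p1 q2 p2 in
  let B := hatB1 thoo1 q1 p1 q2 p2 in
  let S := B + gauge_form w in
  x ^- 2 *: da + x^-1 *: db + dc + E2
    + lie (x ^- 2 *: a + x^-1 *: b + c + x *: E2)
          (- (x *: E2) + B + gauge_form w)
  = x ^- 2 *: (da + lie a S)
    + x^-1 *: (db + lie b S - lie a E2)
    + (dc + E2 + lie c S - lie b E2).
Proof.
move=> x0 c B S; rewrite /S /c /B /hatAoom1 /hatB1.
have [a1 [a2 [a3 [a4 ->]]]] := mx2P a; have [b1 [b2 [b3 [b4 ->]]]] := mx2P b.
have [d1 [d2 [d3 [d4 ->]]]] := mx2P da.
have [e1 [e2 [e3 [e4 ->]]]] := mx2P db; have [f1 [f2 [f3 [f4 ->]]]] := mx2P dc.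
rewrite /lie /gauge_form E2E !mx2E.
by congr mx2; field.
Qed.

(** * Differentials of the hatted matrices *)

Lemma hatA0m1E (t1 q1 q2 : C) :
  hatA0m1 t1 q1 q2 = mx2 (- (q1 * q2)) (q2 * (q1 * q2 + t1)) (- q1) (q1 * q2 + t1).
Proof.
rewrite /hatA0m1; apply/matrixP => i j; rewrite !mxE big_ord1 !mxE.
by case: ifP; case: ifP => _ _; ring.
Qed.

(** The total differentials of the hatted matrices, as functions of the
    differentials dt1, dt2, dq1, ... of their arguments. *)
Definition dhatA0m1 (t1 q1 q2 dt1 dq1 dq2 : C) : 'M[C]_2 :=
  mx2 (- (dq1 * q2 + q1 * dq2))
      (dq2 * (q1 * q2 + t1) + q2 * (dq1 * q2 + q1 * dq2 + dt1))
      (- dq1)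
      (dq1 * q2 + q1 * dq2 + dt1).

Definition dhatA00 (th0 t1 q1 p1 q2 p2 dt1 dq1 dp1 dq2 dp2 : C) : 'M[C]_2 :=
  mx2 (- (dp1 * q1 + p1 * dq1) + (dp2 * q2 + p2 * dq2))
      (- dq2 * (p2 * q2 - th0) - q2 * (dp2 * q2 + p2 * dq2)
       + dp1 * (2 * q1 * q2 + t1) + p1 * (2 * (dq1 * q2 + q1 * dq2) + dt1))
      dp2
      (dp1 * q1 + p1 * dq1 - (dp2 * q2 + p2 * dq2)).

Definition dhatAoom1 (q1 p1 q2 p2 dt2 dq1 dp1 dq2 dp2 : C) : 'M[C]_2 :=
  mx2 0 (dp1 * q1 + p1 * dq1 - (dp2 * q2 + p2 * dq2)) 0 (- dt2).

Section Differentials.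
Variables (q1 p1 q2 p2 : C * C -> C) (t v : C * C) (dq1 dp1 dq2 dp2 : C).
Hypotheses (q1d : is_derive t v q1 dq1) (p1d : is_derive t v p1 dp1)
  (q2d : is_derive t v q2 dq2) (p2d : is_derive t v p2 dp2).

Lemma hatA0m1_derive : mx_is_derive t v (fun s => hatA0m1 s.1 (q1 s) (q2 s))
  (dhatA0m1 t.1 (q1 t) (q2 t) v.1 dq1 dq2).
Proof.
under eq_fun do rewrite hatA0m1E.
by notypeclasses refine (mx_is_derive_mx2 _ _ _ _); derive_by ltac:(ring).
Qed.

Lemma hatA00_derive th0 : mx_is_derive t v
  (fun s => hatA00 th0 s.1 (q1 s) (p1 s) (q2 s) (p2 s))
  (dhatA00 th0 t.1 (q1 t) (p1 t) (q2 t) (p2 t) v.1 dq1 dp1 dq2 dp2).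
Proof.
by notypeclasses refine (mx_is_derive_mx2 _ _ _ _); derive_by ltac:(ring).
Qed.

Lemma hatAoom1_derive thoo1 : mx_is_derive t v
  (fun s => hatAoom1 thoo1 s.2 (q1 s) (p1 s) (q2 s) (p2 s))
  (dhatAoom1 (q1 t) (p1 t) (q2 t) (p2 t) v.2 dq1 dp1 dq2 dp2).
Proof.
by notypeclasses refine (mx_is_derive_mx2 _ _ _ _); derive_by ltac:(ring).
Qed.
End Differentials.

(** * Solving the coefficient equations *)

(** The left-hand side is the contraction of the matrix m with the row (1, -q)
    and the column (q, 1). That row annihilates that column, and the coefficient
    of x^-2 in A is the column (q2, 1) times a row r; so for q = q2 the
    contraction of the differential of this coefficient is dq2 times the product
    of r with (q2, 1), which is t1. *)
Lemma contract_eq0 (m1 m2 m3 m4 q : C) :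
  m1 = 0 -> m2 = 0 -> m3 = 0 -> m4 = 0 ->
  q * m1 + m2 - q ^+ 2 * m3 - q * m4 = 0.
Proof. by move=> -> -> -> ->; rewrite !mulr0 !subr0 addr0. Qed.

Lemma curvature_t1_coeffs_eq0
    (th0 thoo1 t1 t2 q1 p1 q2 p2 dq1 dp1 dq2 dp2 w : C) :
  t1 != 0 ->
  let a := hatA0m1 t1 q1 q2 in
  let b := hatA00 th0 t1 q1 p1 q2 p2 in
  let c := hatAoom1 thoo1 t2 q1 p1 q2 p2 in
  let da := dhatA0m1 t1 q1 q2 1 dq1 dq2 in
  let db := dhatA00 th0 t1 q1 p1 q2 p2 1 dq1 dp1 dq2 dp2 in
  let dc := dhatAoom1 q1 p1 q2 p2 0 dq1 dp1 dq2 dp2 in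
  [/\ da + lie a (gauge_form w) - t1^-1 *: (a + lie b a) = 0,
      db + lie b (gauge_form w) - t1^-1 *: lie c a = 0 &
      dc + lie c (gauge_form w) - t1^-1 *: lie E2 a = 0] <->
  [/\ dq1 = (2 * p1 * q1 ^+ 2 - q1 ^+ 2 + (th0 + 1) * q1) / t1 + p2,
      dp1 = - (2 * p1 ^+ 2 * q1 - (2 * q1 - th0 - 1) * p1 + thoo1) / t1
            + q2 * (q2 - p2 + t2) / t1,
      dq2 = q1 * q2 / t1 + p1,
      dp2 = q1 * (2 * q2 - p2 + t2) / t1 + 1 &
      w = - q1 / t1].
Proof.
move=> t10 /=; rewrite hatA0m1E E2E /hatA00 /hatAoom1 /dhatA0m1 /dhatA00.
rewrite /dhatAoom1 /lie /gauge_form !mx2E; split.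
  move=> [/mx2_eq0[e1 e2 e3 e4] /mx2_eq0[f1 f2 f3 f4] /mx2_eq0[_ _ g _]].
  have wE : w = - q1 / t1 by apply/subr0_eq; rewrite -[RHS]g; field.
  have dq1E : dq1 = (2 * p1 * q1 ^+ 2 - q1 ^+ 2 + (th0 + 1) * q1) / t1 + p2.
    by apply/subr0_eq/oppr_inj; rewrite oppr0 -[RHS]e3 wE; field.
  have dq2E : dq2 = q1 * q2 / t1 + p1.
    apply: (mulfI t10); apply/subr0_eq.
    by rewrite -[RHS](contract_eq0 q2 e1 e2 e3 e4) wE; field.
  have dp2E : dp2 = q1 * (2 * q2 - p2 + t2) / t1 + 1.
    by apply/subr0_eq; rewrite -[RHS]f3 wE; field.
  (* In the contraction of f1, ..., f4 the terms in dq1 and dp2 cancel. *)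
  split=> //; apply: (mulfI t10); apply/subr0_eq.
  by rewrite -[RHS](contract_eq0 q2 f1 f2 f3 f4) wE dq2E; field.
move=> [-> -> -> -> ->]; split; apply/mx2_eq0; split; by field.
Qed.

Lemma curvature_t2_coeffs_eq0
    (th0 thoo1 t1 t2 q1 p1 q2 p2 dq1 dp1 dq2 dp2 w : C) :
  t1 != 0 ->
  let a := hatA0m1 t1 q1 q2 in
  let b := hatA00 th0 t1 q1 p1 q2 p2 in
  let c := hatAoom1 thoo1 t2 q1 p1 q2 p2 in
  let S := hatB1 thoo1 q1 p1 q2 p2 + gauge_form w in
  let da := dhatA0m1 t1 q1 q2 0 dq1 dq2 in
  let db := dhatA00 th0 t1 q1 p1 q2 p2 0 dq1 dp1 dq2 dp2 in
  let dc := dhatAoom1 q1 p1 q2 p2 1 dq1 dp1 dq2 dp2 in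
  [/\ da + lie a S = 0, db + lie b S - lie a E2 = 0 &
      dc + E2 + lie c S - lie b E2 = 0] <->
  [/\ dq1 = - q1 * (p2 - 2 * q2 - t2) + t1,
      dp1 = p1 * (p2 - 2 * q2 - t2) + q2,
      dq2 = q2 * (2 * p2 - q2 - t2) + thoo1 - p1 * q1,
      dp2 = q1 - p2 * (p2 - 2 * q2 - t2) - th0 - 2 * p1 * q1 &
      w = t2 - p2].
Proof.
move=> t10 /=; rewrite hatA0m1E E2E /hatA00 /hatAoom1 /hatB1 /dhatA0m1 /dhatA00.
rewrite /dhatAoom1 /lie /gauge_form !mx2E; split.
  move=> [/mx2_eq0[e1 e2 e3 e4] /mx2_eq0[f1 f2 f3 f4] /mx2_eq0[_ _ g _]].
  have wE : w = t2 - p2 by apply/subr0_eq; rewrite -[RHS]g; ring.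
  have dq1E : dq1 = - q1 * (p2 - 2 * q2 - t2) + t1.
    by apply/subr0_eq/oppr_inj; rewrite oppr0 -[RHS]e3 wE; ring.
  have dq2E : dq2 = q2 * (2 * p2 - q2 - t2) + thoo1 - p1 * q1.
    apply: (mulfI t10); apply/subr0_eq.
    by rewrite -[RHS](contract_eq0 q2 e1 e2 e3 e4) wE; ring.
  have dp2E : dp2 = q1 - p2 * (p2 - 2 * q2 - t2) - th0 - 2 * p1 * q1.
    by apply/subr0_eq; rewrite -[RHS]f3 wE; ring.
  (* In the contraction of f1, ..., f4 the terms in dq1 and dp2 cancel. *)
  split=> //; apply: (mulfI t10); apply/subr0_eq.
  by rewrite -[RHS](contract_eq0 q2 f1 f2 f3 f4) wE dq2E; ring.
by move=> [-> -> -> -> ->]; split; apply/mx2_eq0; split; ring.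
Qed.

(** * Hamilton's equations in explicit form *)

Lemma derive1_val (f : C -> C) x df :
  is_derive x (1 : C) f df -> derive1 f x = df.
Proof. by move=> fdf; rewrite derive1E derive_val. Qed.

Lemma hamilton_eqs_Ht1 (th0 thoo1 : C) (v : C * C) q1 p1 q2 p2 t : t.1 != 0 ->
  hamilton_eqs v (Ht1 th0 thoo1) q1 p1 q2 p2 t =
  [/\ 'D_v q1 t = (2 * p1 t * q1 t ^+ 2 - q1 t ^+ 2 + (th0 + 1) * q1 t) / t.1 + p2 t,
      'D_v p1 t = - (2 * p1 t ^+ 2 * q1 t - (2 * q1 t - th0 - 1) * p1 t + thoo1) / t.1
                  + q2 t * (q2 t - p2 t + t.2) / t.1,
      'D_v q2 t = q1 t * q2 t / t.1 + p1 t &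
      'D_v p2 t = q1 t * (2 * q2 t - p2 t + t.2) / t.1 + 1].
Proof.
move=> t0; rewrite /hamilton_eqs /Ht1 /HIII_D6.
congr and4; congr (_ = _);
  [| rewrite -[RHS]opprK; congr (- _) | | rewrite -[RHS]opprK; congr (- _)];
  notypeclasses refine (derive1_val _); derive_by ltac:(by field).
Qed.

Lemma hamilton_eqs_Ht2 (th0 thoo1 : C) (v : C * C) q1 p1 q2 p2 t :
  hamilton_eqs v (Ht2 th0 thoo1) q1 p1 q2 p2 t =
  [/\ 'D_v q1 t = - q1 t * (p2 t - 2 * q2 t - t.2) + t.1,
      'D_v p1 t = p1 t * (p2 t - 2 * q2 t - t.2) + q2 t,
      'D_v q2 t = q2 t * (2 * p2 t - q2 t - t.2) + thoo1 - p1 t * q1 t &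
      'D_v p2 t = q1 t - p2 t * (p2 t - 2 * q2 t - t.2) - th0 - 2 * p1 t * q1 t].
Proof.
rewrite /hamilton_eqs /Ht2 /HIV.
congr and4; congr (_ = _);
  [| rewrite -[RHS]opprK; congr (- _) | | rewrite -[RHS]opprK; congr (- _)];
  notypeclasses refine (derive1_val _); derive_by ltac:(ring).
Qed.
(** * Flatness at a point for each time *)

Lemma and5_and4 (P1 P2 P3 P4 P5 : Prop) :
  [/\ P1, P2, P3, P4 & P5] <-> [/\ P1, P2, P3 & P4] /\ P5.
Proof. by split=> [[]|[[]]]. Qed.

Section Flatness.
Variables (th0 thoo1 : C) (q1 p1 q2 p2 u : C * C -> C) (t : C * C).
Hypotheses (t10 : t.1 != 0) (u0 : u t != 0).
Hypotheses (q1d : forall v, is_derive t v q1 ('D_v q1 t))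
  (p1d : forall v, is_derive t v p1 ('D_v p1 t))
  (q2d : forall v, is_derive t v q2 ('D_v q2 t))
  (p2d : forall v, is_derive t v p2 ('D_v p2 t))
  (ud : forall v, is_derive t v u ('D_v u t)).

(** Its gauge transform is [laxA], by conversion. *)
Let hatA (s : C * C) (y : C) : 'M[C]_2 :=
  y ^- 2 *: hatA0m1 s.1 (q1 s) (q2 s)
  + y^-1 *: hatA00 th0 s.1 (q1 s) (p1 s) (q2 s) (p2 s)
  + hatAoom1 thoo1 s.2 (q1 s) (p1 s) (q2 s) (p2 s) + y *: E2.

Lemma hatA_derive v x : mx_is_derive t v (hatA ^~ x)
  (x ^- 2 *: dhatA0m1 t.1 (q1 t) (q2 t) v.1 ('D_v q1 t) ('D_v q2 t)
   + x^-1 *: dhatA00 th0 t.1 (q1 t) (p1 t) (q2 t) (p2 t) v.1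
       ('D_v q1 t) ('D_v p1 t) ('D_v q2 t) ('D_v p2 t)
   + dhatAoom1 (q1 t) (p1 t) (q2 t) (p2 t) v.2
       ('D_v q1 t) ('D_v p1 t) ('D_v q2 t) ('D_v p2 t)).
Proof.
rewrite -[X in mx_is_derive _ _ _ X]addr0.
apply: mx_is_deriveD; last exact: mx_is_derive_cst.
apply: mx_is_deriveD; last exact: hatAoom1_derive.
apply: mx_is_deriveD; apply: mx_is_deriveZ.
  exact: hatA0m1_derive.
exact: hatA00_derive.
Qed.

Lemma flat_t1 :
  (forall x, x != 0 -> zero_curvature dt1 (laxA th0 thoo1 q1 p1 q2 p2 u)
     (laxB1 q1 q2 u) t x = 0) <->
  hamilton_eqs dt1 (Ht1 th0 thoo1) q1 p1 q2 p2 t /\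
  (u t)^-1 * 'D_dt1 u t = - q1 t / t.1.
Proof.
pose a := hatA0m1 t.1 (q1 t) (q2 t).
pose Bh (y : C) := - (t.1 * y)^-1 *: a.
have BE : laxB1 q1 q2 u t = fun y => gauge u t (Bh y).
  by apply/funext => y; rewrite gaugeZ.
have Bd x : x != 0 -> mx_is_derive x (1 : C) Bh ((t.1 * x ^+ 2)^-1 *: a).
  move=> x0 i j; rewrite mxE; under eq_fun do rewrite mxE.
  have denom : is_derive x (1 : C) (fun y => t.1 * y) t.1.
    by derive_by ltac:(ring).
  have denom0 : t.1 * x != 0 by rewrite mulf_neq0.
  have Vd := is_derive_invf denom0 denom.
  derive_by ltac:(by field; rewrite t10 x0).
rewrite hamilton_eqs_Ht1 //.
rewrite -[X in _ <-> X](_ : [/\ _, _, _, _ & _] <-> _); last first.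
  exact: and5_and4.
rewrite -curvature_t1_coeffs_eq0 // -mx_laurent_eq0.
split=> flat x x0; move: (flat x x0);
  rewrite (zero_curvature_gauge u0 (ud dt1) (hatA_derive dt1 x) (Bd x x0) BE);
  by rewrite gauge_eq0 // curvature_t1_laurent.
Qed.

Lemma flat_t2 :
  (forall x, x != 0 -> zero_curvature dt2 (laxA th0 thoo1 q1 p1 q2 p2 u)
     (laxB2 thoo1 q1 p1 q2 p2 u) t x = 0) <->
  hamilton_eqs dt2 (Ht2 th0 thoo1) q1 p1 q2 p2 t /\
  (u t)^-1 * 'D_dt2 u t = t.2 - p2 t.
Proof.
pose Bh (y : C) : 'M[C]_2 :=
  - (y *: E2) + hatB1 thoo1 (q1 t) (p1 t) (q2 t) (p2 t).
have BE : laxB2 thoo1 q1 p1 q2 p2 u t = fun y => gauge u t (Bh y).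
  by apply/funext => y; rewrite gaugeD gaugeN gaugeZ gauge_E2.
have Bd x : mx_is_derive x (1 : C) Bh (- E2).
  rewrite /Bh; move: (@E2 R) (hatB1 _ _ _ _ _) => M N i j.
  by rewrite mxE; under eq_fun do rewrite !mxE; derive_by ltac:(ring).
rewrite hamilton_eqs_Ht2 -[X in _ <-> X](_ : [/\ _, _, _, _ & _] <-> _); last first.
  exact: and5_and4.
rewrite -curvature_t2_coeffs_eq0 // -mx_laurent_eq0.
split=> flat x x0; move: (flat x x0);
  rewrite (zero_curvature_gauge u0 (ud dt2) (hatA_derive dt2 x) (Bd x) BE);
  by rewrite gauge_eq0 // opprK curvature_t2_laurent.
Qed.
End Flatness.

End LaxPairs.

Unset Implicit Arguments.

Theorem mainTheorem16 (R : realType) (th0 thoo1 thoo2 : CC R)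
    (hth : th0 + thoo1 + thoo2 = 0)
    (D : set (CC R * CC R)) (hD : domain D)
    (hDt1 : forall t, D t -> t.1 != 0)
    (q1 p1 q2 p2 u : CC R * CC R -> CC R)
    (hq1 : holomorphic_on D q1) (hp1 : holomorphic_on D p1)
    (hq2 : holomorphic_on D q2) (hp2 : holomorphic_on D p2)
    (hu : holomorphic_on D u) (hu0 : forall t, D t -> u t != 0) :
  let A := laxA th0 thoo1 q1 p1 q2 p2 u in
  let B1 := laxB1 q1 q2 u in
  let B2 := laxB2 thoo1 q1 p1 q2 p2 u in
  (forall (t : CC R * CC R) (x : CC R), D t -> x != 0 ->
     zero_curvature dt1 A B1 t x = 0 /\ zero_curvature dt2 A B2 t x = 0)
  <->
  (forall t, D t ->
     [/\ hamilton_eqs dt1 (Ht1 th0 thoo1) q1 p1 q2 p2 t,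
         hamilton_eqs dt2 (Ht2 th0 thoo1) q1 p1 q2 p2 t,
         (u t)^-1 * 'D_dt1 u t = - q1 t / t.1 &
         (u t)^-1 * 'D_dt2 u t = t.2 - p2 t]).
Proof.
move=> A B1 B2.
have partial f (t v : CC R * CC R) : holomorphic_on D f -> D t ->
    is_derive t v f ('D_v f t).
  by move=> hf Dt; apply/derivableP/diff_derivable/hf.
have flat1 t (Dt : D t) := flat_t1 th0 thoo1 (hDt1 t Dt) (hu0 t Dt)
  (fun v => partial _ t v hq1 Dt) (fun v => partial _ t v hp1 Dt)
  (fun v => partial _ t v hq2 Dt) (fun v => partial _ t v hp2 Dt)
  (fun v => partial _ t v hu Dt).
have flat2 t (Dt : D t) := flat_t2 th0 thoo1 (hDt1 t Dt) (hu0 t Dt)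
  (fun v => partial _ t v hq1 Dt) (fun v => partial _ t v hp1 Dt)
  (fun v => partial _ t v hq2 Dt) (fun v => partial _ t v hp2 Dt)
  (fun v => partial _ t v hu Dt).
split=> [flat t Dt|ham t x Dt x0].
  have [|ham1 u1] := (flat1 t Dt).1 _.
    by move=> x x0; exact: (flat t x Dt x0).1.
  have [|ham2 u2] := (flat2 t Dt).1 _.
    by move=> x x0; exact: (flat t x Dt x0).2.
  by split.
have [ham1 ham2 u1 u2] := ham t Dt.
by split; [exact: (flat1 t Dt).2 | exact: (flat2 t Dt).2].
Qed.
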